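(* Let $A$ be a bounded normal operator on $\mathcal{H}$, let $\mu$ be its scalar spectral measure, and let $\mathcal{G}$ be a countable system of vectors in $\mathcal{H}$. (a) If $\{A^n g\}_{g\in\mathcal{G},\,n\ge0}$ is complete in $\mathcal{H}$ and for every $g\in\mathcal{G}$ the system $\{A^n g\}_{n\ge0}$ is Bessel in $\mathcal{H}$, then $\mu(\mathbb{C}\setminus\overline{\mathbb{D}}_1)=0$ and $\mu|_{S_1}$ is absolutely continuous with respect to arc length measure (Lebesgue measure) on $S_1$. (b) If $\{A^n g\}_{g\in\mathcal{G},\,n\ge0}$ is a frame for $\mathcal{H}$, then $\mu(\mathbb{C}\setminus\mathbb{D}_1)=0$.
   Context: $\mathcal{H}$ is an infinite-dimensional separable complex Hilbert space. $\mathbb{D}_1$ is the open unit disk in $\mathbb{C}$, $\overline{\mathbb{D}}_1$ its closure, $S_1=\overline{\mathbb{D}}_1\setminus\mathbb{D}_1$ the unit circle. Systems are families indexed by $(g,n)$ (resp. $n$). A family $\{f_i\}_{i\in I}$ is complete if its closed linear span is $\mathcal{H}$; Bessel if there is $\beta\ge0$ with $\sum_i|\langle f,f_i\rangle|^2\le\beta\|f\|^2$ for all $f\in\mathcal{H}$; a frame if there are $\alpha,\beta>0$ with $\alpha\|f\|^2\le\sum_i|\langle f,f_i\rangle|^2\le\beta\|f\|^2$ for all $f\in\mathcal{H}$. Scalar spectral measure: by the spectral theorem with multiplicity, there are mutually singular compactly supported non-negative Borel measures $\mu_j$ on $\mathbb{C}$, $j\in\{1,2,\dots\}\cup\{\infty\}$,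 such that $A$ is unitarily equivalent to $N^{(\infty)}_{\mu_\infty}\oplus N_{\mu_1}\oplus N^{(2)}_{\mu_2}\oplus\cdots$, where $N_{\mu_j}$ is multiplication by $z$ on $L^2(\mu_j)$ and $N^{(j)}_{\mu_j}$ is the direct sum of $j$ copies of it. The scalar spectral measure is $\mu=\sum_{1\le j\le\infty}\mu_j$ (well defined up to mutual absolute continuity). *)

(* Defs.v *)
From HB Require Import structures.
From mathcomp Require Import all_boot all_order all_algebra.
From mathcomp Require Import sesquilinear.
From mathcomp Require Import complex.
From mathcomp Require Import all_classical all_reals all_analysis.

Set Implicit Arguments.
Unset Strict Implicit.
Unset Printing Implicit Defensive.

Import Order.TTheory GRing.Theory Num.Theory.
Import numFieldNormedType.Exports.

Local Open Scope classical_set_scope.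
Local Open Scope complex_scope.
Local Open Scope ring_scope.

(* R[i] is given its Borel sigma-algebra; its topology is carried by the alias
   R[i]^o. *)
HB.instance Definition _ (R : realType) := Measurable.copy R[i]
  (g_sigma_algebraType (@open R[i]^o)).

(* A norm over R[i] takes its values in R[i]; this is the same number in R. *)
Definition rnorm (R : realType) (V : normedZmodType R[i]) (x : V) : R :=
  complex.Re `|x|.

Section systems.
Context (R : realType) (H : completeNormedModType R[i]).
Context (ip : {dot H for @conjc R}).

Definition infinite_dimensional : Prop :=
  ~ exists (n : nat) (b : 'I_n -> H),
      forall x, exists c : 'I_n -> R[i], x = \sum_(i < n) c i *: b i.

Definition separable : Prop := exists2 D : set H, countable D & dense D.

Definition bounded_operator (A : {linear H -> H}) : Prop :=
  exists M : R, forall x, rnorm (A x) <= M * rnorm x.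

Definition is_adjoint (A B : H -> H) : Prop :=
  forall x y, ip (A x) y = ip x (B y).

Definition normal_operator (A : {linear H -> H}) : Prop :=
  exists B : H -> H, is_adjoint A B /\ forall x, A (B x) = B (A x).

Definition lin_span (I : Type) (f : I -> H) : set H :=
  [set x | exists (s : seq I) (c : I -> R[i]), x = \sum_(i <- s) c i *: f i].

Definition complete_system (I : Type) (f : I -> H) : Prop :=
  closure (lin_span f) = [set: H].

Definition coef_energy (I : choiceType) (f : I -> H) (x : H) : \bar R :=
  (\esum_(i in [set: I]) (rnorm (ip x (f i)) ^+ 2)%:E)%E.

Definition bessel (I : choiceType) (f : I -> H) : Prop :=
  exists2 beta : R, 0 <= beta &
    forall x, (coef_energy f x <= (beta * rnorm x ^+ 2)%:E)%E.

Definition frame (I : choiceType) (f : I -> H) : Prop :=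
  exists alpha beta : R, [/\ 0 < alpha, 0 < beta &
    forall x, ((alpha * rnorm x ^+ 2)%:E <= coef_energy f x)%E /\
              (coef_energy f x <= (beta * rnorm x ^+ 2)%:E)%E].

Definition orbit_system (A : H -> H) (I : Type) (g : I -> H) (p : I * nat) : H :=
  iter p.2 A (g p.1).

End systems.

Section scalar_spectral_measure.
Context (R : realType).

Definition mutually_singular (mu nu : set R[i] -> \bar R) : Prop :=
  exists B : set R[i], [/\ measurable B, mu B = 0%E & nu (~` B) = 0%E].

Definition compactly_supported (mu : set R[i] -> \bar R) : Prop :=
  exists2 K : set R[i]^o, compact K & mu (~` K) = 0%E.

(* Multiplicities {1, 2, ...} u {oo} are encoded by option nat: Some n is the
   multiplicity n.+1 and None is oo. *)
Definition copies (j : option nat) : set nat :=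
  if j is Some n then `I_n.+1 else [set: nat].

(* (j, k) is the index of the k-th copy of L^2(mu_ j). *)
Definition summands : set (option nat * nat) := [set p | copies p.1 p.2].

(* The Hilbert space direct sum of the L^2(mu_ j), each taken with its
   multiplicity: a vector is represented by a family of functions, and
   sum_ae_eq is equality of the vectors represented. *)
Definition sum_sqnorm (mu_ : option nat -> {measure set R[i] -> \bar R})
    (F : option nat * nat -> R[i] -> R[i]) : \bar R :=
  (\esum_(p in summands) \int[mu_ p.1]_z (rnorm (F p z) ^+ 2)%:E)%E.

Definition in_L2sum (mu_ : option nat -> {measure set R[i] -> \bar R})
    (F : option nat * nat -> R[i] -> R[i]) : Prop :=
  (forall p, summands p -> measurable_fun [set: R[i]] (F p)) /\
  (sum_sqnorm mu_ F < +oo)%E.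

Definition sum_ae_eq (mu_ : option nat -> {measure set R[i] -> \bar R})
    (F G : option nat * nat -> R[i] -> R[i]) : Prop :=
  forall p, summands p -> ae_eq (mu_ p.1) [set: R[i]] (F p) (G p).

(* A is carried by a unitary U onto multiplication by z in every summand. *)
Definition multiplication_model (H : completeNormedModType R[i])
    (A : {linear H -> H}) (mu_ : option nat -> {measure set R[i] -> \bar R}) :
    Prop :=
  exists U : H -> option nat * nat -> R[i] -> R[i],
  [/\ forall x, in_L2sum mu_ (U x),
      forall (a : R[i]) x y, sum_ae_eq mu_ (U (a *: x + y))
                               (fun p z => a * U x p z + U y p z),
      forall x, sum_sqnorm mu_ (U x) = (rnorm x ^+ 2)%:E,
      forall F, in_L2sum mu_ F -> exists x, sum_ae_eq mu_ (U x) F &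
      forall x, sum_ae_eq mu_ (U (A x)) (fun p z => z * U x p z)].

Definition scalar_spectral_measure (H : completeNormedModType R[i])
    (A : {linear H -> H}) (mu : {measure set R[i] -> \bar R}) : Prop :=
  exists mu_ : option nat -> {finite_measure set R[i] -> \bar R},
  [/\ forall j, compactly_supported (mu_ j),
      forall j k, j != k -> mutually_singular (mu_ j) (mu_ k),
      multiplication_model A (fun j => mu_ j) &
      forall B, measurable B ->
        mu B = (\esum_(j in [set: option nat]) mu_ j B)%E].

End scalar_spectral_measure.

Section disk.
Context (R : realType).

Definition open_disk : set R[i] := [set z | `|z| < 1].
Definition closed_disk : set R[i] := [set z | `|z| <= 1].
Definition unit_circle : set R[i] := closed_disk `\` open_disk.

Lemma measurable_open_disk : measurable open_disk.
Proof.
apply: sub_sigma_algebra; rewrite (_ : open_disk = ball (0 : R[i]^o) 1).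
  exact: ball_open.
by apply/seteqP; split=> z; rewrite -ball_normE /ball_ /open_disk /= sub0r normrN.
Qed.

Lemma measurable_closed_disk : measurable closed_disk.
Proof.
rewrite -[X in measurable X]setCK; apply: measurableC.
apply: sub_sigma_algebra; change (open (~` closed_disk : set R[i]^o)).
rewrite openE => z /= /negP; rewrite -real_ltNge// => z1.
apply/nbhs_ballP; exists (`|z| - 1); first by rewrite /= subr_gt0.
move=> w; rewrite -ball_normE /= => zw; apply/negP.
rewrite -real_ltNge//; have := ler_normD (z - w) w; rewrite subrK => zle.
have := le_lt_trans zle (ltr_leD zw (lexx `|w|)).
by rewrite -ltrBlDl opprB addrC subrK.
Qed.

Lemma measurable_unit_circle : measurable unit_circle.
Proof.
exact: measurableD measurable_closed_disk measurable_open_disk.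
Qed.

Definition circle_param (t : R) : R[i] := cos t +i* sin t.

Definition arc_length : set R[i] -> \bar R :=
  pushforward (mrestr (@lebesgue_measure R) (measurable_itv `[0, 2 * pi[))
    circle_param.

End disk.

Arguments open_disk R : clear implicits.
Arguments closed_disk R : clear implicits.
Arguments unit_circle R : clear implicits.
Arguments measurable_unit_circle R : clear implicits.
Arguments circle_param R : clear implicits.
Arguments arc_length R : clear implicits.

(* Main.v *)
From HB Require Import structures.
Require Import Defs.
From mathcomp Require Import all_boot all_order all_algebra.
From mathcomp Require Import sesquilinear.
From mathcomp Require Import complex.
From mathcomp Require Import ring lra.
From mathcomp Require Import all_classical all_reals all_analysis.
From mathcomp Require Import measurable_realfun.
Import Order.TTheory GRing.Theory Num.Theory.
Import numFieldNormedType.Exports.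
Local Open Scope classical_set_scope.
Local Open Scope complex_scope.
Local Open Scope ring_scope.

(** Write [U x p] for the component of the vector [x] in the [p]-th summand of the
    multiplication model of [A], and [density m h] for the measure |h|^2 dm.

    The Bessel inequality bounds the synthesis operator ([bessel_synthesis]): the
    squared norm of a finite sum of the c_n A^n g is at most b * sum_n |c_n|^2. In
    the model such a sum is q * U g with q(z) = sum_n c_n z^n, whence for every
    summand, with nu = |U g p|^2 dmu_p,

      int |q|^2 dnu <= b * sum_n |c_n|^2     for every polynomial q.

    Two families of polynomials are then tested. The monomials z^n show that nu
    vanishes outside the closed disk ([density_outside]). The geometric sums
    q(z) = sum_(n < N) (conj(w) z)^n with |w| = 1, whose squared modulus is N times
    a Fejer kernel, are at least N/2 in modulus on the arc |z - w| <= 1/N, while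
    sum_n |c_n|^2 = N; thus nu gives that arc mass at most 4b/N ([density_near]).
    Covering a set of zero arc length by short arcs, nu gives it mass 0
    ([arc_length_null]).

    Consequently, on a set E that is outside the closed disk, or on the circle and
    of zero arc length, all generators g vanish almost everywhere. The vector
    represented by the indicator of E in one summand is then orthogonal to all
    A^n g, so it is 0 by completeness, which says that E is null for the measure of
    that summand ([model_null_of_total]). This is (a).

    A frame is total and each of its orbits is Bessel, so for (b) only the circle
    remains. Let x be represented by the indicator of the circle in one summand.
    Then |A^m x| = |x|, and |A*^m x| = |x| because A is normal. But the
    coefficients of A*^m x against the A^n g are those of x with n shifted by m, so
    their energy is a tail of a convergent sum, and the lower frame bound forces
    x = 0 ([frame_orbit_isometric]). *)

Set Implicit Arguments.
Unset Strict Implicit.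
Unset Printing Implicit Defensive.

(** * The real-valued norm *)

Section rnorm_theory.
Context (R : realType).
Implicit Types V : normedZmodType R[i].

Lemma rnormE V (x : V) : (rnorm x)%:C = `|x|.
Proof. by rewrite /rnorm RRe_real ?normr_real. Qed.

Lemma rnorm_ge0 V (x : V) : 0 <= rnorm x.
Proof. by rewrite -ler0c rnormE. Qed.

Lemma rnorm0 V : rnorm (0 : V) = 0.
Proof. by rewrite /rnorm normr0. Qed.

Lemma rnorm_eq0 V (x : V) : (rnorm x == 0) = (x == 0).
Proof. by rewrite -(inj_eq (@complexI R)) rnormE normr_eq0. Qed.

Lemma rnormD V (x y : V) : rnorm (x + y) <= rnorm x + rnorm y.
Proof. by rewrite -lecR rmorphD/= !rnormE ler_normD. Qed.

Lemma rnormM (a b : R[i]) : rnorm (a * b) = rnorm a * rnorm b.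
Proof. by apply: (@complexI R); rewrite rmorphM/= !rnormE normrM. Qed.

Lemma rnormN V (x : V) : rnorm (- x) = rnorm x.
Proof. by rewrite /rnorm normrN. Qed.

Lemma rnormX (a : R[i]) n : rnorm (a ^+ n) = rnorm a ^+ n.
Proof. by apply: (@complexI R); rewrite rmorphXn/= !rnormE normrX. Qed.

Lemma rnorm1 : rnorm (1 : R[i]) = 1.
Proof. by rewrite /rnorm normr1. Qed.

Lemma rnormJ (a : R[i]) : rnorm a^*%C = rnorm a.
Proof. by rewrite /rnorm normcJ. Qed.

Lemma rnorm_sum V (I : Type) (r : seq I) (P : pred I) (F : I -> V) :
  rnorm (\sum_(i <- r | P i) F i) <= \sum_(i <- r | P i) rnorm (F i).
Proof.
elim/big_ind2 : _ => [|x1 x2 y1 y2 h1 h2|//]; first by rewrite rnorm0.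
by rewrite (le_trans (rnormD _ _))// lerD.
Qed.

Lemma rnorm_sqrE (z : R[i]) : rnorm z ^+ 2 = complex.Re z ^+ 2 + complex.Im z ^+ 2.
Proof.
by apply: (@complexI R); rewrite rmorphXn/= rnormE -add_Re2_Im2.
Qed.

Lemma rnorm_real (a : R) : 0 <= a -> rnorm (a%:C : R[i]) = a.
Proof.
by move=> a0; apply: (@complexI R); rewrite rnormE ger0_norm ?ler0c.
Qed.

End rnorm_theory.

(** * Hilbert space lemmas *)

Section energy.
Context (R : realType) (H : completeNormedModType R[i]).
Context (ip : {dot H for @conjc R}).

(** The energy of a subfamily is at most that of the family. *)
Lemma coef_energy_comp (I J : choiceType) (f : I -> H) (e : J -> I) x :
  injective e -> (coef_energy ip (f \o e) x <= coef_energy ip f x)%E.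
Proof.
move=> ie; rewrite /coef_energy.
rewrite -(esum_image [set: J] e (fun i => (rnorm (ip x (f i)) ^+ 2)%:E)); last first.
  by move=> ? ? _ _; exact: ie.
apply: le_ereal_sup => _ [X [fX _] <-]; exists X => //.
Qed.

Lemma sum_coef_energy (f : nat -> H) x N :
  ((\sum_(n < N) rnorm (ip x (f n)) ^+ 2)%:E <= coef_energy ip f x)%E.
Proof.
apply: esum_ge; exists `I_N; first by split; [exact: finite_II|].
by rewrite -fsbig_ord sumEFin.
Qed.

End energy.

Section hilbert.
Context (R : realType) (H : completeNormedModType R[i]).
Context (ip : {dot H for @conjc R}).
Hypothesis H_hilbert : forall x : H, `|x| ^+ 2 = ip x x.

Lemma ip_conj x y : ip x y = (ip y x)^*%C.
Proof. by rewrite hermitian_subproof mul1r. Qed.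

Lemma ip_linl (a : R[i]) x y z : ip (a *: x + y) z = a * ip x z + ip y z.
Proof. by rewrite linearDl linearZl_LR. Qed.

Lemma ip_linr (a : R[i]) x y z : ip z (a *: x + y) = a^*%C * ip z x + ip z y.
Proof. by rewrite linearDr linearZr_LR. Qed.

Lemma conjcM (a b : R[i]) : (a * b)^*%C = a^*%C * b^*%C.
Proof. by rewrite rmorphM. Qed.

Lemma ip_sqrE x : ((rnorm x) ^+ 2)%:C = ip x x.
Proof. by rewrite rmorphXn/= rnormE H_hilbert. Qed.

Lemma rnorm_sqrD (a : R[i]) x y : rnorm (a *: x + y) ^+ 2 =
  rnorm a ^+ 2 * rnorm x ^+ 2 + rnorm y ^+ 2 + 2 * complex.Re (a * ip x y).
Proof.
apply: (@complexI R); rewrite ip_sqrE.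
have aE : (rnorm a ^+ 2)%:C = a * a^*%C by rewrite rmorphXn/= rnormE sqr_normc.
move: aE (ip_sqrE x) (ip_sqrE y).
move: (rnorm a ^+ 2) (rnorm x ^+ 2) (rnorm y ^+ 2) => u v w uE vE wE.
rewrite 2!rmorphD/= 2!rmorphM/= uE vE wE rmorph_nat -addcJ.
rewrite ip_linl !ip_linr [ip y x]ip_conj conjcM.
by ring.
Qed.

(** Polarization: the Pythagorean identity for all unimodular multiples of [x]
    forces orthogonality. Thus orthogonality can be read off norms alone. *)
Lemma orthogonal_of_pythagoras x y :
  (forall a : R[i], rnorm a = 1 ->
     rnorm (a *: x + y) ^+ 2 = rnorm x ^+ 2 + rnorm y ^+ 2) ->
  ip x y = 0.
Proof.
move=> pyth.
(* The scalars 1 and i give the real and the imaginary part of [ip x y]. *)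
have Re0 a : rnorm a = 1 -> complex.Re (a * ip x y) = 0.
  move=> a1; have := pyth a a1; rewrite rnorm_sqrD a1 expr1n mul1r.
  move/eqP; rewrite -[X in _ == X]addr0 (inj_eq (addrI _)) mulf_eq0 pnatr_eq0/=.
  by move/eqP.
apply/eqP; rewrite eq_complex /=; apply/andP; split; apply/eqP.
  by have := Re0 1; rewrite mul1r rnorm1; apply.
have := Re0 'i%C; rewrite mulrC ReiNIm => iE; apply/eqP.
rewrite -oppr_eq0; apply/eqP; apply: iE.
by apply/eqP; rewrite -(@eqrXn2 _ 2) ?rnorm_ge0// rnorm_sqrE/= expr0n add0r expr1n.
Qed.

(** If [x] is orthogonal to the span, every [y] of the span satisfies
    |x - y| >= |x|, so that [x <> 0] cannot be approximated by the span. *)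
Lemma orthogonal_complete (I : Type) (f : I -> H) x :
  complete_system f -> (forall i, ip x (f i) = 0) -> x = 0.
Proof.
move=> cf xf; apply/eqP; apply/negPn/negP => x0.
have [y [[s [c yE]]]] : lin_span f `&` ball x `|x| !=set0.
  have : closure (lin_span f) x by rewrite cf.
  by apply; apply: nbhsx_ballx; rewrite normr_gt0.
rewrite -ball_normE/= -rnormE -[X in _ < X]rnormE ltcR.
have xy : ip y x = 0.
  rewrite yE linear_sumlz big1// => i _; rewrite linearZl_LR/= ip_conj xf.
  by rewrite conjc0 mulr0.
rewrite -(@ltr_pXn2r _ 2) ?nnegrE ?rnorm_ge0// addrC -scaleN1r rnorm_sqrD xy.
by rewrite mulr0 mulr0 addr0 rnormN rnorm1 expr1n mul1r ltNge lerDr sqr_ge0.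
Qed.

(** The dual form of the Bessel inequality: the synthesis operator has the same
    bound as the analysis operator. *)
Lemma bessel_synthesis (f : nat -> H) (b : R) : 0 < b ->
  (forall x, (coef_energy ip f x <= (b * rnorm x ^+ 2)%:E)%E) ->
  forall N (c : nat -> R[i]),
  rnorm (\sum_(n < N) c n *: f n) ^+ 2 <= b * \sum_(n < N) rnorm (c n) ^+ 2.
Proof.
move=> b0 fb N c; set y := \sum_(n < N) _.
have yE : rnorm y ^+ 2 <= \sum_(n < N) rnorm (c n) * rnorm (ip y (f n)).
  have -> : rnorm y ^+ 2 = rnorm (ip y y).
    by rewrite -ip_sqrE rnorm_real// sqr_ge0.
  rewrite {2}/y linear_sumr; apply: (le_trans (rnorm_sum _ _ _)).
  by apply: ler_sum => n _; rewrite linearZr_LR/= rnormM rnormJ.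
have ybd : \sum_(n < N) rnorm (ip y (f n)) ^+ 2 <= b * rnorm y ^+ 2.
  by rewrite -lee_fin; apply: le_trans (fb y); exact: sum_coef_energy.
(* The weights are chosen so that the energy of [y] contributes exactly half of
   the squared norm of [y]. *)
have amgm : \sum_(n < N) rnorm (c n) * rnorm (ip y (f n)) <=
    \sum_(n < N) (b / 2 * rnorm (c n) ^+ 2 + (2 * b)^-1 * rnorm (ip y (f n)) ^+ 2).
  apply: ler_sum => n _; rewrite -subr_ge0.
  set u := rnorm _; set v := rnorm _.
  suff -> : b / 2 * u ^+ 2 + (2 * b)^-1 * v ^+ 2 - u * v =
      (2 * b)^-1 * (b * u - v) ^+ 2.
    by rewrite mulr_ge0 ?sqr_ge0// invr_ge0 mulr_ge0// ltW.
  by field; rewrite gt_eqF.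
have : rnorm y ^+ 2 <= b / 2 * \sum_(n < N) rnorm (c n) ^+ 2 + rnorm y ^+ 2 / 2.
  apply: (le_trans yE); apply: (le_trans amgm).
  rewrite big_split/= -!mulr_sumr lerD2l.
  rewrite (_ : _ / 2 = (2 * b)^-1 * (b * rnorm y ^+ 2)); last first.
    by field; rewrite gt_eqF.
  by rewrite ler_wpM2l// invr_ge0 mulr_ge0// ltW.
by lra.
Qed.

End hilbert.

Section frames.
Context (R : realType) (H : completeNormedModType R[i]).
Context (ip : {dot H for @conjc R}).
Hypothesis H_hilbert : forall x : H, `|x| ^+ 2 = ip x x.

(** A frame is total: only 0 is orthogonal to all of its members. *)
Lemma frame_orthogonal (I : choiceType) (f : I -> H) x :
  frame ip f -> (forall i, ip x (f i) = 0) -> x = 0.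
Proof.
move=> [a [b [a0 b0 fab]]] xf; have [+ _] := fab x.
rewrite /coef_energy esum1; last by move=> i _; rewrite xf rnorm0 expr0n.
rewrite lee_fin pmulr_rle0// => x0; apply/eqP.
by rewrite -rnorm_eq0 -sqrf_eq0 eq_le x0 sqr_ge0.
Qed.

Lemma frame_orbit_bessel (A : H -> H) (G : countType) (g : G -> H) :
  frame ip (orbit_system A g) ->
  forall i, bessel ip (fun n : nat => iter n A (g i)).
Proof.
move=> [a [b [a0 b0 fab]]] i; exists b; first exact: ltW.
move=> x; have [_] := fab x; apply: le_trans.
by apply: (@coef_energy_comp _ _ _ _ _ (orbit_system A g) (pair i)) => m n [].
Qed.

Section normal.
Context (A : {linear H -> H}) (B : H -> H).
Hypothesis AB : is_adjoint ip A B.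
Hypothesis ABC : forall x, A (B x) = B (A x).

Lemma adjoint_iter m x y : ip (iter m B x) y = ip x (iter m A y).
Proof.
elim: m y => //= m IH y.
by rewrite ip_conj -AB -ip_conj IH -iterSr.
Qed.

Lemma rnorm_normal x : rnorm (B x) = rnorm (A x).
Proof.
apply/eqP; rewrite -(@eqrXn2 _ 2) ?rnorm_ge0//; apply/eqP/(@complexI R).
by rewrite !(ip_sqrE H_hilbert) AB -ABC [RHS]ip_conj AB -ip_conj.
Qed.

Lemma rnorm_normal_iter m x : rnorm (iter m B x) = rnorm (iter m A x).
Proof.
elim: m x => //= m IH x; rewrite rnorm_normal.
have -> : A (iter m B x) = iter m B (A x).
  by elim: m {IH} => //= m <-; rewrite ABC.
by rewrite IH -iterSr.
Qed.

(** Applying the [m]-th power of the adjoint to [x] keeps only the coefficients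
    of [x] against the vectors A^n g with n >= m. *)
Lemma coef_energy_adjoint_iter (G : countType) (g : G -> H) m x :
  coef_energy ip (orbit_system A g) (iter m B x) =
  coef_energy ip (orbit_system A g \o (fun p => (p.1, (m + p.2)%N))) x.
Proof.
apply: eq_esum => -[i n] _; rewrite /orbit_system/= adjoint_iter.
by rewrite -iterD.
Qed.

(** The energy of [iter m B x] is a tail of the convergent energy of [x], hence
    tends to 0; but the lower frame bound keeps it above [a * rnorm x ^+ 2],
    since the norm of [iter m B x] is that of [x]. *)
Lemma frame_orbit_isometric (G : countType) (g : G -> H) x :
  frame ip (orbit_system A g) ->
  (forall m, rnorm (iter m A x) = rnorm x) -> x = 0.
Proof.
move=> [a [b [a0 b0 fab]]] xA; apply/eqP; apply/negPn/negP => x0.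
pose c := a * rnorm x ^+ 2.
have c0 : 0 < c by rewrite mulr_gt0// exprn_gt0// lt_def rnorm_eq0 x0 rnorm_ge0.
pose f (p : G * nat) := (rnorm (ip x (orbit_system A g p)) ^+ 2)%:E.
have f0 p : (0 <= f p)%E by rewrite lee_fin sqr_ge0.
pose T := esum [set: G * nat] f.
have T0 : (0 <= T)%E by apply: esum_ge0 => p _; exact: f0.
have Tfin : T \is a fin_num.
  rewrite ge0_fin_numE//.
  by have [_ /le_lt_trans] := fab x; apply; rewrite ltry.
have : (T - c%:E < T)%E.
  by rewrite lteBlDr// lteDl// lte_fin.
move=> /ereal_sup_gt[_ [F [finF _] <-] TF].
(* The finite set [F] carries all of the energy up to [c]; the tail starting at
   [m] avoids it. *)
have [m Fm] : exists m : nat, forall p, F p -> (p.2 < m)%N.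
  exists (\max_(p <- finmap.enum_fset (fset_set F)) p.2).+1 => p Fp; rewrite ltnS.
  apply: (@leq_bigmax_seq _ _ xpredT (fun p => p.2)) => //.
  by rewrite in_fset_set// inE.
have tailE : (c%:E <= esum (~` F) f)%E.
  have [+ _] := fab (iter m B x); rewrite rnorm_normal_iter xA => /le_trans; apply.
  rewrite coef_energy_adjoint_iter /coef_energy.
  rewrite -(esum_image [set: G * nat] (fun p : G * nat => (p.1, (m + p.2)%N)) f).
    apply: le_ereal_sup => _ [X [fX XI] <-]; exists X => //; split => // p Xp Fp.
    have [q _ qp] := XI _ Xp; have := Fm _ Fp.
    by rewrite -qp /= ltnNge leq_addr.
  by move=> [i n] [i' n'] _ _ /= [-> /addnI ->].
have TE : (T = \sum_(p \in F) f p + esum (~` F) f)%E.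
  by rewrite [LHS](esumID F _ f (fun p _ => f0 p)) !setTI esum_fset.
move: TF; apply/negP; rewrite -leNgt TE leeBrDr//.
exact: leeD.
Qed.

End normal.
End frames.

(** * Borel sets of the complex plane and the unit circle *)

Section borel.
Context (R : realType).

Lemma measurable_rnorm_gt (a : R) (w : R[i]) :
  measurable [set z : R[i] | a < rnorm (z - w)].
Proof.
apply: sub_sigma_algebra.
change (open ([set z | a < rnorm (z - w)] : set R[i]^o)).
rewrite openE => z /= az.
apply/nbhs_ballP; exists ((rnorm (z - w) - a)%:C); first by rewrite /= ltcR subr_gt0.
move=> v; rewrite -ball_normE /= -rnormE ltcR => zv.
have := rnormD (z - v) (v - w); rewrite addrA subrK.
by lra.
Qed.

Lemma measurable_rnorm d (T : measurableType d) (F : T -> R[i]) :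
  measurable_fun [set: T] F -> measurable_fun [set: T] (fun t => rnorm (F t)).
Proof.
move=> mF.
apply: (@measurableT_comp _ _ _ _ _ _ (fun z : R[i] => rnorm z) _ F) => //.
apply: (measurability _ (RGenOInfty.measurableE R)) => //.
move=> _ [_ [a ->] <-]; rewrite setTI.
rewrite (_ : _ @^-1` _ = [set z | a < rnorm (z - 0)]).
  exact: measurable_rnorm_gt.
by apply/seteqP; split=> z /=; rewrite in_itv/= andbT subr0.
Qed.

Lemma measurable_rnorm_sqr d (T : measurableType d) (F : T -> R[i]) :
  measurable_fun [set: T] F ->
  measurable_fun [set: T] (fun t => (rnorm (F t) ^+ 2)%:E).
Proof.
move=> mF; apply/measurable_EFinP; apply: measurable_funX.
exact: measurable_rnorm.
Qed.

(** The closed disk of centre [w] and radius [r], with a real radius. *)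
Definition cdisk (w : R[i]) (r : R) : set R[i] := [set z | rnorm (z - w) <= r].

Lemma measurable_cdisk (w : R[i]) (r : R) : measurable (cdisk w r).
Proof.
rewrite /cdisk (_ : [set z | _] = ~` [set z | r < rnorm (z - w)]).
  by apply: measurableC; exact: measurable_rnorm_gt.
by apply/seteqP; split=> z /=; [move=> h; apply/negP; rewrite -leNgt|
  move/negP; rewrite -leNgt].
Qed.

End borel.

Section circle.
Context (R : realType).

Lemma open_diskE (z : R[i]) : open_disk R z <-> rnorm z < 1.
Proof. by rewrite /open_disk /= -rnormE ltcR. Qed.

Lemma closed_diskE (z : R[i]) : closed_disk R z <-> rnorm z <= 1.
Proof. by rewrite /closed_disk /= -rnormE lecR. Qed.

Lemma unit_circleE (z : R[i]) : unit_circle R z <-> rnorm z = 1.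
Proof.
split=> [[/closed_diskE z1 /open_diskE/negP]|z1].
  by rewrite -leNgt => z2; apply/eqP; rewrite eq_le z1.
by split; [apply/closed_diskE; rewrite z1|apply/open_diskE; rewrite z1 ltxx].
Qed.

Lemma rnorm_circle_param t : rnorm (circle_param R t) = 1.
Proof.
apply/eqP; rewrite -(@eqrXn2 _ 2) ?rnorm_ge0// rnorm_sqrE/= cos2Dsin2.
by rewrite expr1n.
Qed.

Lemma circle_param_surj (z : R[i]) : unit_circle R z ->
  exists2 t, t \in `[0, 2 * pi[ & circle_param R t = z.
Proof.
move=> /unit_circleE z1; have := rnorm_sqrE z; rewrite z1 expr1n.
case: z {z1} => x y /= xy1.
have xI : -1 <= x <= 1 by have := sqr_ge0 y; nra.
have cx : cos (acos x) = x by rewrite acosK// in_itv.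
have pi0 := pi_gt0 R.
have a0 := acos_ge0 xI; have ap := acos_lepi xI.
have sx : sin (acos x) = `|y|.
  by rewrite sin_acos// (_ : 1 - x ^+ 2 = y ^+ 2) ?sqrtr_sqr//; lra.
have [y0|y0] := leP 0 y.
  exists (acos x); first by rewrite in_itv/= a0/=; lra.
  by rewrite /circle_param cx sx ger0_norm.
exists (2 * pi - acos x); last first.
  rewrite /circle_param [2 * pi]mulrC mulr_natr addrC.
  by rewrite cosD2pi sinD2pi cosN sinN cx sx ltr0_norm// opprK.
rewrite in_itv/=; apply/andP; split; first by lra.
rewrite ltrBlDr ltrDl lt_def a0 andbT; apply/eqP => ax0.
by move: sx; rewrite ax0 sin0 ltr0_norm// => /eqP; rewrite eq_sym oppr_eq0 lt_eqF.
Qed.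

(** The constant 2 is not optimal: cosine and sine are each 1-Lipschitz. *)
Lemma circle_param_lipschitz s t :
  rnorm (circle_param R s - circle_param R t) <= 2 * `|s - t|.
Proof.
wlog st : s t / t <= s => [h|].
  have [ts|/ltW ts] := leP t s; first exact: h.
  by rewrite -rnormN opprB distrC; exact: h.
have lip (f f' : R -> R) : (forall x : R, is_derive x 1 f (f' x)) ->
    continuous f -> (forall x, `|f' x| <= 1) -> `|f s - f t| <= `|s - t|.
  move=> df cf f'1; have [|c _ ->] := @MVT_segment _ f f' _ _ st.
    exact: continuous_subspaceT.
  by rewrite normrM ler_piMl.
have hc : `|cos s - cos t| <= `|s - t|.
  apply: (lip cos (fun x => - sin x)) => [|x]; first exact: continuous_cos.
  by rewrite normrN ler_norml sin_geN1 sin_le1.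
have hs : `|sin s - sin t| <= `|s - t|.
  apply: (lip sin cos) => [|x]; first exact: continuous_sin.
  by rewrite ler_norml cos_geN1 cos_le1.
rewrite -(@ler_pXn2r _ 2) ?nnegrE ?rnorm_ge0 ?mulr_ge0// rnorm_sqrE/=.
rewrite -[leLHS]/((cos s - cos t) ^+ 2 + (sin s - sin t) ^+ 2).
rewrite -[X in X + _]real_normK ?num_real// -[X in _ + X]real_normK ?num_real//.
have := normr_ge0 (cos s - cos t); have := normr_ge0 (sin s - sin t).
have := normr_ge0 (s - t).
move: hc hs; move: `|cos s - cos t| `|sin s - sin t| `|s - t| => u v w.
by nra.
Qed.


End circle.

(** * Measures that are small on small disks charge no null set of the circle *)

Section arc_length_null.
Context (R : realType).

(** Every small [2 * d] is at most some 1/N of comparable size. *)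
Lemma inv_nat_between (d : R) : 0 < d -> d <= 2^-1 ->
  exists2 N, (0 < N)%N & 2 * d <= N%:R^-1 /\ N%:R^-1 <= 4 * d.
Proof.
move=> d0 d1; set r := (2 * d)^-1.
have r0 : 0 < r by rewrite invr_gt0 mulr_gt0.
have r1 : 1 <= r by rewrite invf_ge1 ?mulr_gt0//; lra.
have rd : r * d = 2^-1 by rewrite /r; field; rewrite gt_eqF.
have /andP[] := truncn_itv (ltW r0); set N := Num.truncn r => Nr rN.
have N0 : (0 < N)%N by rewrite truncn_gt0.
have NR : 1 <= (N%:R : R) by rewrite ler1n.
exists N => //; split.
  by rewrite -[leLHS]invrK -/r lef_pV2// posrE ltr0n.
rewrite -[N%:R^-1]mul1r ler_pdivrMr ?ltr0n//.
by move: rN; rewrite -natr1; nra.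
Qed.

Context (nu : {measure set R[i] -> \bar R}) (C : R).
Hypothesis C0 : 0 <= C.
(* The part of the circle within 1/N of a point of the circle has measure
   O(1/N). *)
Hypothesis nuC : forall (w : R[i]) (N : nat), unit_circle R w -> (0 < N)%N ->
  (nu (cdisk w N%:R^-1 `&` unit_circle R) <= (C / N%:R)%:E)%E.

(** The arc over a short interval lies in a Borel set whose measure is controlled
    by the length of the interval. *)
Lemma circle_param_itv_cover (a b : R) : b - a <= 2^-1 ->
  exists D, [/\ measurable D,
    circle_param R @` `]a, b[%classic `<=` D &
    (nu D <= (4 * C)%:E * wlength idfun `]a, b[%classic)%E].
Proof.
move=> ab; have [ba|{}ab'] := leP b a.
  exists set0; split => //; last first.
    by rewrite measure0 mule_ge0 ?lee_fin ?mulr_ge0// wlength_itv_ge0.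
  by rewrite set_itv_ge ?image_set0// bnd_simp -leNgt.
have [|N N0 [dN Nd]] := @inv_nat_between (b - a) _ ab; first by rewrite subr_gt0.
exists (cdisk (circle_param R a) N%:R^-1 `&` unit_circle R).
split.
- by apply: measurableI; [exact: measurable_cdisk|exact: measurable_unit_circle].
- move=> z [t /=]; rewrite in_itv/= => /andP[ta tb] <-; split => /=; last first.
    by apply/unit_circleE; exact: rnorm_circle_param.
  apply: (le_trans (circle_param_lipschitz _ _)); apply: le_trans dN.
  by rewrite ler_pM2l// ger0_norm ?subr_ge0 ?lerD2r ltW.
- apply: (le_trans (nuC _ N0)).
    by apply/unit_circleE; exact: rnorm_circle_param.
  rewrite wlength_itv_bnd ?(ltW ab')//= -EFinM lee_fin.
  by rewrite -mulrA [leRHS]mulrCA ler_wpM2l.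
Qed.

(** Parameters of [E] form a Lebesgue null set, hence are covered by countably
    many intervals of arbitrarily small total length. *)
Lemma arc_length_null E : measurable E -> arc_length R E = 0%E ->
  nu (E `&` unit_circle R) = 0%E.
Proof.
move=> mE E0; pose T := circle_param R @^-1` E `&` `[0, 2 * pi[%classic.
(* Lebesgue measure is by definition the outer measure of interval length. *)
have T0 : ((wlength idfun)^* T)%mu = 0%E by [].
apply/eqP; rewrite eq_le measure_ge0 andbT; apply/lee_addgt0Pr => e e0.
rewrite add0e.
(* [d <= 1/2] makes every interval of the cover short enough for
   [circle_param_itv_cover]; [d <= e / (4 * C + 1)] bounds the final sum. *)
pose d := Num.min 2^-1 (e / (4 * C + 1)).
have C1 : 0 < 4 * C + 1 by rewrite ltr_wpDl// mulr_ge0.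
have d0 : 0 < d by rewrite lt_min invr_gt0 ltr0n/= divr_gt0.
have [F [Fitv TF] Fd] : exists2 I_, open_itv_cover T I_ &
    (\sum_(0 <= k <oo) wlength idfun (I_ k) < d%:E)%E.
  have : ((wlength idfun)^* T)%mu \is a fin_num by rewrite T0.
  rewrite outer_measure_open_itv_cover.
  move=> /lb_ereal_inf_adherent-/(_ _ d0)[_/= [F]] AF <-.
  by rewrite -outer_measure_open_itv_cover T0 add0e => Fd; exists F.
have l0 k : (0 <= wlength idfun (F k))%E.
  by have [[a b] ->] := Fitv k; rewrite wlength_itv_ge0.
have ld k : (wlength idfun (F k) < d%:E)%E.
  apply: le_lt_trans Fd.
  apply: le_trans (nneseries_lim_ge k.+1 _); last by move=> n _ _; exact: l0.
  by rewrite big_nat_recr//= leeDr// sume_ge0.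
have /choice[D DP] k : exists D, [/\ measurable D,
    circle_param R @` F k `<=` D &
    (nu D <= (4 * C)%:E * wlength idfun (F k))%E].
  have := ld k; have [[a b] ->] := Fitv k => lab.
  apply: circle_param_itv_cover.
  have [ba|ab] := leP b a.
    by apply: (@le_trans _ _ 0); [rewrite subr_le0|rewrite invr_ge0].
  move: lab; rewrite wlength_itv_bnd ?(ltW ab)//= lte_fin lt_min => /andP[+ _].
  by move/ltW.
have ED : E `&` unit_circle R `<=` \bigcup_k D k.
  move=> z [Ez /circle_param_surj[t t2pi tz]].
  have [|k _ Fkt] := TF t; first by split => //=; rewrite tz.
  by exists k => //; have [_ + _] := DP k; apply; exists t.
have : (nu (E `&` unit_circle R) <= \sum_(k <oo) nu (D k))%E.
  apply: measure_sigma_subadditive => //.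
    by move=> k; have [] := DP k.
  by apply: measurableI => //; exact: measurable_unit_circle.
move=> /le_trans; apply.
apply: (@le_trans _ _ (\sum_(0 <= k <oo) ((4 * C)%:E * wlength idfun (F k)))%E).
  by apply: lee_nneseries => // k _; have [] := DP k.
rewrite nneseriesZl ?lee_fin ?mulr_ge0//.
apply: (@le_trans _ _ ((4 * C)%:E * d%:E)%E).
  by rewrite lee_wpmul2l ?lee_fin ?mulr_ge0// ltW.
rewrite -EFinM lee_fin.
apply: (@le_trans _ _ (4 * C * (e / (4 * C + 1)))).
  by rewrite ler_wpM2l ?mulr_ge0// ge_min lexx orbT.
rewrite mulrA ler_pdivrMr// mulrC ler_pM2l//.
by rewrite lerDl.
Qed.

End arc_length_null.

(** * Densities dominated on polynomials *)

Section density.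
Context (R : realType) (m : {measure set R[i] -> \bar R}).

(** The inequality int |q|^2 |h|^2 dm <= b * sum_n |c_n|^2 for every polynomial
    q = sum_n c_n z^n. The product [q * h] enters through a measurable function
    [y] that is almost everywhere equal to it. *)
Definition poly_bounded (h : R[i] -> R[i]) (b : R) : Prop :=
  forall N (c : nat -> R[i]), exists2 y : R[i] -> R[i],
  measurable_fun [set: R[i]] y /\
  ae_eq m [set: R[i]] y (fun z => (\sum_(n < N) c n * z ^+ n) * h z) &
  (\int[m]_z (rnorm (y z) ^+ 2)%:E <= (b * \sum_(n < N) rnorm (c n) ^+ 2)%:E)%E.

Context (h : R[i] -> R[i]) (mh : measurable_fun [set: R[i]] h).

(** The measure |h|^2 dm. *)
Definition density (X : set R[i]) : \bar R :=
  (\int[m]_(z in X) (rnorm (h z) ^+ 2)%:E)%E.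

Let density_integrand_ge0 z : (0 <= (rnorm (h z) ^+ 2)%:E)%E.
Proof. by rewrite lee_fin sqr_ge0. Qed.

Let density_integrand_measurable (X : set R[i]) :
  measurable_fun X (fun z => (rnorm (h z) ^+ 2)%:E).
Proof. by apply: measurable_funS (measurable_rnorm_sqr mh). Qed.

Let density0 : density set0 = 0%E. Proof. exact: integral_set0. Qed.

Let density_ge0 X : (0 <= density X)%E. Proof. by apply: integral_ge0. Qed.

Let density_sigma_additive : semi_sigma_additive density.
Proof.
move=> F mF tF mUF; rewrite /density ge0_integral_bigcup//.
by apply: is_cvg_nneseries => n _ _; exact: density_ge0.
Qed.

HB.instance Definition _ := isMeasure.Build _ _ _ density
  density0 density_ge0 density_sigma_additive.

Context (b : R) (b0 : 0 <= b).
Hypothesis poly_bound : poly_bounded h b.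

(** Chebyshev inequality for the polynomial with coefficients [c]. *)
Lemma density_chebyshev N (c : nat -> R[i]) (k : R) (X : set R[i]) :
  measurable X -> 0 <= k ->
  (forall z, X z -> k <= rnorm (\sum_(n < N) c n * z ^+ n) ^+ 2) ->
  (k%:E * density X <= (b * \sum_(n < N) rnorm (c n) ^+ 2)%:E)%E.
Proof.
move=> mX k0 kX; have [y [my yE] yb] := poly_bound N c.
rewrite /density -ge0_integralZl_EFin//.
apply: le_trans yb.
apply: (@le_trans _ _ (\int[m]_(z in X) (rnorm (y z) ^+ 2)%:E)%E).
  apply: ae_ge0_le_integral => //.
  - by move=> z _; rewrite mule_ge0.
  - by apply: measurable_funeM.
  - by move=> z _; rewrite lee_fin sqr_ge0.
  - exact: measurable_funS (measurable_rnorm_sqr my).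
  apply: filterS yE => z /(_ I) -> Xz.
  by rewrite -EFinM lee_fin rnormM exprMn ler_wpM2r ?sqr_ge0// kX.
apply: ge0_subset_integral => //.
- exact: measurable_rnorm_sqr.
- by move=> z _; rewrite lee_fin sqr_ge0.
Qed.

(** Outside a disk of radius [r > 1] the monomials z^n grow without bound while
    their coefficients keep norm 1. *)
Lemma density_far (r : R) : 1 < r -> density [set z | r < rnorm (z - 0)] = 0%E.
Proof.
move=> r1; set X := [set z | _].
have mX : measurable X by exact: measurable_rnorm_gt.
have Xb n : (((r ^+ 2) ^+ n)%:E * density X <= b%:E)%E.
  pose c i : R[i] := (i == n)%:R.
  have := @density_chebyshev n.+1 c ((r ^+ 2) ^+ n) X mX.
  rewrite big_ord_recr/= /c eqxx rnorm1 expr1n big1 ?add0r ?mulr1; last first.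
    by move=> i _; rewrite (ltn_eqF (ltn_ord i)) rnorm0 expr0n.
  apply; first by rewrite exprn_ge0// sqr_ge0.
  move=> z; rewrite /X/= subr0 => rz; rewrite big_ord_recr/= eqxx mul1r big1 ?add0r.
    rewrite rnormX [leRHS]exprAC; apply: lerXn2r; rewrite ?nnegrE ?sqr_ge0//.
    apply: lerXn2r; rewrite ?nnegrE ?rnorm_ge0//; last exact: ltW.
    by apply/ltW/(lt_trans ltr01).
  by move=> i _; rewrite (ltn_eqF (ltn_ord i)) mul0r.
have fX : density X \is a fin_num.
  rewrite ge0_fin_numE//; have := Xb 0%N; rewrite expr0 mul1e => /le_lt_trans.
  by apply; rewrite ltry.
apply/eqP; rewrite -(fineK fX) eqe; apply/negPn/negP => v0.
have {}v0 : 0 < fine (density X) by rewrite lt_def v0 fine_ge0.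
move: Xb; rewrite -(fineK fX); move: (fine _) v0 => v v0 Xb.
(* Bernoulli inequality. *)
have bern (q : R) n : 0 <= q -> 1 + n%:R * (q - 1) <= q ^+ n.
  move=> q0; elim: n => [|n IH]; first by rewrite mul0r addr0 expr0.
  rewrite exprS -natr1; have n0 : 0 <= (n%:R : R) by [].
  have h' : q * (1 + n%:R * (q - 1)) <= q * q ^+ n by rewrite ler_wpM2l.
  by apply: le_trans h'; have := sqr_ge0 (q - 1); nra.
have d0 : 0 < (r ^+ 2 - 1) * v by rewrite mulr_gt0// subr_gt0; nra.
(* By Bernoulli, this exponent makes r^(2n) * v exceed [b]. *)
have := Xb (Num.truncn (b / ((r ^+ 2 - 1) * v))).+1.
rewrite -EFinM lee_fin; apply/negP; rewrite -ltNge.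
have := truncnS_gt (b / ((r ^+ 2 - 1) * v)).
set n := (Num.truncn _).+1; rewrite ltr_pdivrMr// => bn.
apply: (lt_le_trans bn); have := bern (r ^+ 2) n (sqr_ge0 r).
rewrite mulrA => /(ler_wpM2r (ltW v0)) h'.
by apply: le_trans h'; rewrite mulrDl mul1r lerDr ltW.
Qed.

Lemma rnorm_sub1X_le (u : R[i]) n : rnorm u = 1 ->
  rnorm (1 - u ^+ n) <= n%:R * rnorm (1 - u).
Proof.
move=> u1; elim: n => [|n IH]; first by rewrite expr0 subrr rnorm0 mul0r.
have -> : 1 - u ^+ n.+1 = (1 - u ^+ n) + u ^+ n * (1 - u).
  by rewrite mulrBr mulr1 addrA subrK exprSr.
apply: (le_trans (rnormD _ _)); rewrite rnormM rnormX u1 expr1n mul1r.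
by rewrite -natr1 mulrDl mul1r lerD2r.
Qed.

(** On the arc |z - w| <= 1/N the terms of the geometric sum are still close
    enough to 1 for the sum to be at least N/2. *)
Lemma rnorm_geometric_sum (z w : R[i]) N : rnorm w = 1 -> rnorm z = 1 ->
  (0 < N)%N -> rnorm (z - w) <= N%:R^-1 ->
  N%:R / 2 <= rnorm (\sum_(n < N) (w^*%C) ^+ n * z ^+ n).
Proof.
move=> w1 z1 N0 zw; set u := w^*%C * z.
have u1 : rnorm u = 1 by rewrite rnormM rnormJ w1 z1 mulr1.
have uw : rnorm (1 - u) = rnorm (z - w).
  rewrite -rnormN opprB -[RHS]mul1r -w1 -[rnorm w]rnormJ -rnormM mulrBr.
  by rewrite [_ * w]mulrC -sqr_normc -rnormE w1 expr1n.
under eq_bigr do rewrite -exprMn -/u.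
have sN : \sum_(n < N) rnorm (1 - u ^+ n) <= N%:R / 2.
  apply: (@le_trans _ _ (\sum_(n < N) (n%:R * N%:R^-1))).
    apply: ler_sum => n _; apply: (le_trans (rnorm_sub1X_le _ u1)).
    by rewrite ler_wpM2l// uw.
  have -> : \sum_(n < N) (n%:R * N%:R^-1) = N%:R * (N%:R - 1) / 2 / N%:R :> R.
    rewrite -mulr_suml; congr (_ / _).
    elim: {N0 zw} N => [|N IH]; first by rewrite big_ord0 !mul0r.
    by rewrite big_ord_recr/= IH -natr1; field.
  have NR : 1 <= (N%:R : R) by rewrite ler1n.
  rewrite ler_pdivrMr ?ltr0n//; nra.
have : N%:R = rnorm (\sum_(n < N) u ^+ n + \sum_(n < N) (1 - u ^+ n)).
  rewrite -big_split/= (eq_bigr (fun=> 1)); last by move=> n _; rewrite addrC subrK.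
  rewrite sumr_const card_ord -(rmorph_nat (real_complex R)) rnorm_real//.
move: (rnormD (\sum_(n < N) u ^+ n) (\sum_(n < N) (1 - u ^+ n))).
move: (rnorm_sum (index_enum 'I_N) xpredT (fun n : 'I_N => 1 - u ^+ n)).
by lra.
Qed.

(** The polynomial with coefficients conj(w)^n is at least N/2 in modulus near
    [w], whereas the sum of the squared moduli of its coefficients is N. *)
Lemma density_near (w : R[i]) N : unit_circle R w -> (0 < N)%N ->
  (density (cdisk w N%:R^-1 `&` unit_circle R) <= (4 * b / N%:R)%:E)%E.
Proof.
move=> /unit_circleE w1 N0; set X := _ `&` _.
have mX : measurable X.
  by apply: measurableI; [exact: measurable_cdisk|exact: measurable_unit_circle].
have := @density_chebyshev N (fun n => (w^*%C) ^+ n) ((N%:R / 2) ^+ 2) X mX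
  (sqr_ge0 _).
rewrite (eq_bigr (fun=> 1)); last first.
  by move=> n _; rewrite rnormX rnormJ w1 !expr1n.
rewrite sumr_const card_ord => Xb.
have NR : 0 < (N%:R : R) by rewrite ltr0n.
have k0 : 0 < ((N%:R / 2) ^+ 2 : R) by rewrite exprn_gt0// divr_gt0.
rewrite -(@lee_pmul2l _ ((N%:R / 2) ^+ 2)%:E)//.
apply: (le_trans (Xb _)).
  move=> z [zw /unit_circleE z1]; rewrite ler_pXn2r ?nnegrE ?rnorm_ge0 ?divr_ge0//.
  exact: rnorm_geometric_sum.
rewrite -EFinM lee_fin le_eqVlt; apply/orP; left; apply/eqP.
by field; rewrite gt_eqF.
Qed.

Lemma density_outside : density (~` closed_disk R) = 0%E.
Proof.
apply/eqP; rewrite eq_le measure_ge0 andbT.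
pose X k := [set z : R[i] | 1 + k.+1%:R^-1 < rnorm (z - 0)].
have : (density (~` closed_disk R) <= \sum_(k <oo) density (X k))%E.
  apply: measure_sigma_subadditive.
  - by move=> k; exact: measurable_rnorm_gt.
  - by apply: measurableC; exact: measurable_closed_disk.
  - move=> z /closed_diskE/negP; rewrite -ltNge => z1.
    pose k := Num.truncn (rnorm z - 1)^-1; exists k => //; rewrite /X/= subr0.
    have k0 : 0 < rnorm z - 1 by rewrite subr_gt0.
    rewrite -ltrBrDl invf_plt ?posrE ?ltr0n//.
    exact: truncnS_gt.
rewrite eseries0// => k _ _.
by apply: density_far; rewrite ltrDl invr_gt0 ltr0n.
Qed.

Lemma density_circle_null E : measurable E -> arc_length R E = 0%E ->
  density (E `&` unit_circle R) = 0%E.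
Proof.
move=> mE E0; apply: (@arc_length_null _ density (4 * b)) => //.
  by rewrite mulr_ge0.
by move=> w N; exact: density_near.
Qed.

End density.

(** * The multiplication model *)

Section model.
Context (R : realType) (H : completeNormedModType R[i]).
Context (ip : {dot H for @conjc R}).
Hypothesis H_hilbert : forall x : H, `|x| ^+ 2 = ip x x.
Context (A : {linear H -> H}).
Context (mu_ : option nat -> {measure set R[i] -> \bar R}).
Context (U : H -> option nat * nat -> R[i] -> R[i]).
(* [U] is a unitary as in [multiplication_model]. *)
Hypothesis U_L2 : forall x, in_L2sum mu_ (U x).
Hypothesis U_linear : forall (a : R[i]) x y,
  sum_ae_eq mu_ (U (a *: x + y)) (fun p z => a * U x p z + U y p z).
Hypothesis U_isometry : forall x, sum_sqnorm mu_ (U x) = (rnorm x ^+ 2)%:E.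
Hypothesis U_surjective : forall F, in_L2sum mu_ F ->
  exists x, sum_ae_eq mu_ (U x) F.
Hypothesis U_mult : forall x,
  sum_ae_eq mu_ (U (A x)) (fun p z => z * U x p z).

Lemma measurable_model x p : summands p -> measurable_fun [set: R[i]] (U x p).
Proof. by have [+ _] := U_L2 x; apply. Qed.

Lemma model_iter n x :
  sum_ae_eq mu_ (U (iter n A x)) (fun p z => z ^+ n * U x p z).
Proof.
elim: n => [|n IH] p Sp.
  by apply: aeW => z _ /=; rewrite expr0 mul1r.
apply: filterS2 (U_mult (iter n A x) Sp) (IH p Sp) => z /= /(_ I) -> /(_ I) ->.
by rewrite mulrA exprS.
Qed.

Lemma model0 : sum_ae_eq mu_ (U 0) (fun _ _ => 0).
Proof.
move=> p Sp; apply: filterS (U_linear (-1) 0 0 Sp) => z /(_ I).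
by rewrite scaler0 addr0 mulN1r addNr.
Qed.

Lemma model_poly N (c : nat -> R[i]) x :
  sum_ae_eq mu_ (U (\sum_(n < N) c n *: iter n A x))
    (fun p z => (\sum_(n < N) c n * z ^+ n) * U x p z).
Proof.
elim: N => [|N IH] p Sp.
  apply: filterS (model0 Sp) => z /(_ I) z0 _.
  by rewrite !big_ord0 z0 mul0r.
rewrite big_ord_recr/= addrC; set s := \sum_(n < N) _.
apply: filterS3 (U_linear (c N) (iter N A x) s Sp) (model_iter N x Sp) (IH p Sp).
move=> z /(_ I) -> /(_ I) -> /(_ I) -> _.
by rewrite big_ord_recr/= mulrDl addrC mulrA.
Qed.

Lemma model_integral_le x p : summands p ->
  (\int[mu_ p.1]_z (rnorm (U x p z) ^+ 2)%:E <= (rnorm x ^+ 2)%:E)%E.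
Proof.
move=> Sp; rewrite -U_isometry; apply: esum_ge; exists [set p].
  by split; [exact: finite_set1|move=> _ ->].
by rewrite fsbig_set1.
Qed.

(** In the model the synthesis operator of the orbit of [x] multiplies [U x] by a
    polynomial, so the Bessel bound is a bound on polynomial multiples. *)
Lemma model_poly_bound (b : R) x : 0 < b ->
  (forall y, (coef_energy ip (fun n => iter n A x) y <= (b * rnorm y ^+ 2)%:E)%E) ->
  forall p, summands p -> poly_bounded (mu_ p.1) (U x p) b.
Proof.
move=> b0 xb p Sp N c; exists (U (\sum_(n < N) c n *: iter n A x) p).
  by split; [exact: measurable_model|exact: model_poly].
apply: (le_trans (model_integral_le _ Sp)); rewrite lee_fin.
exact: (bessel_synthesis H_hilbert).
Qed.

(** Vectors with disjoint supports in the model are orthogonal. *)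
Lemma model_orthogonal x y :
  (forall p, summands p ->
    ae_eq (mu_ p.1) [set: R[i]] (fun z => U x p z * U y p z) (cst 0)) ->
  ip x y = 0.
Proof.
move=> xy; apply: (orthogonal_of_pythagoras H_hilbert) => a a1.
apply: EFin_inj; rewrite EFinD -!U_isometry /sum_sqnorm -esumD; last 2 first.
- by move=> p _; apply: integral_ge0 => z _; rewrite lee_fin sqr_ge0.
- by move=> p _; apply: integral_ge0 => z _; rewrite lee_fin sqr_ge0.
apply: eq_esum => p Sp.
have mU v : measurable_fun [set: R[i]] (fun z => (rnorm (U v p z) ^+ 2)%:E).
  by apply: measurable_rnorm_sqr; exact: measurable_model.
have U0 v z : (0 <= (rnorm (U v p z) ^+ 2)%:E)%E by rewrite lee_fin sqr_ge0.
rewrite -ge0_integralD//; apply: ge0_ae_eq_integral => //.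
- exact: emeasurable_funD.
- by move=> z _; rewrite adde_ge0.
apply: filterS2 (U_linear a x y Sp) (xy p Sp) => z /(_ I) -> /(_ I) /eqP.
rewrite mulf_eq0 => /orP[]/eqP -> _.
  by rewrite mulr0 add0r rnorm0 expr0n add0e.
by rewrite addr0 rnorm0 expr0n adde0 rnormM a1 mul1r.
Qed.

(* Finiteness puts indicator functions in L^2. *)
Hypothesis mu_fin : forall j, (mu_ j [set: R[i]] < +oo)%E.

(** The element of the direct sum that is the indicator function of [E] in the
    summand [p] and vanishes in the others. *)
Definition slot_indicator (p : option nat * nat) (E : set R[i])
    (q : option nat * nat) (z : R[i]) : R[i] :=
  if (q == p) && (z \in E) then 1 else 0.

Lemma slot_indicator_sqnorm p E : summands p -> measurable E ->
  sum_sqnorm mu_ (slot_indicator p E) = mu_ p.1 E.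
Proof.
move=> Sp mE; rewrite /sum_sqnorm (esumID [set p]); last first.
  by move=> q _; apply: integral_ge0 => z _; rewrite lee_fin sqr_ge0.
rewrite [X in (_ + X)%E]esum1 ?adde0; last first.
  move=> q [_ /eqP qp]; apply: integral0_eq => z _.
  by rewrite /slot_indicator (negbTE qp)/= rnorm0 expr0n.
rewrite setIidr; last by move=> _ ->.
rewrite esum_set1; last first.
  by apply: integral_ge0 => z _; rewrite lee_fin sqr_ge0.
rewrite (eq_integral (fun z => (\1_E z)%:E)).
  by rewrite integral_indic// setIT.
move=> z _; rewrite /slot_indicator eqxx/= indicE.
by case: (z \in E); rewrite ?rnorm1 ?rnorm0 ?expr1n ?expr0n.
Qed.

Lemma slot_indicator_L2 p E : summands p -> measurable E ->
  in_L2sum mu_ (slot_indicator p E).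
Proof.
move=> Sp mE; split; last first.
  rewrite slot_indicator_sqnorm//; apply: le_lt_trans (mu_fin p.1).
  by apply: le_measure => //; rewrite inE.
move=> q _; rewrite /slot_indicator; case: eqP => _ /=; last exact: measurable_cst.
apply: measurable_fun_ifT => //; apply: (@measurable_fun_bool _ _ _ _ true).
rewrite setTI (_ : _ @^-1` _ = E)//.
by apply/seteqP; split=> z /=; [exact: set_mem|exact: mem_set].
Qed.

Lemma slot_indicator_vector p E : summands p -> measurable E ->
  exists x, sum_ae_eq mu_ (U x) (slot_indicator p E) /\
    (rnorm x ^+ 2)%:E = mu_ p.1 E.
Proof.
move=> Sp mE; have [x xE] := U_surjective (slot_indicator_L2 Sp mE).
exists x; split => //; rewrite -slot_indicator_sqnorm// -U_isometry.
apply: eq_esum => q Sq; apply: ge0_ae_eq_integral => //.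
- by apply: measurable_rnorm_sqr; exact: measurable_model.
- by apply: measurable_rnorm_sqr; have [+ _] := slot_indicator_L2 Sp mE; apply.
- by move=> z _; rewrite lee_fin sqr_ge0.
- by move=> z _; rewrite lee_fin sqr_ge0.
by apply: filterS (xE q Sq) => z /(_ I) ->.
Qed.

(** If all generators vanish on [E] in the summand [p], the indicator of [E]
    there is orthogonal to the total system of all orbits, hence is zero. *)
Lemma model_null_of_total (G : countType) (g : G -> H) p E :
  summands p -> measurable E ->
  (forall x, (forall k, ip x (orbit_system A g k) = 0) -> x = 0) ->
  (forall i, density (mu_ p.1) (U (g i) p) E = 0%E) ->
  mu_ p.1 E = 0%E.
Proof.
move=> Sp mE total gE.
have [x [xE <-]] := slot_indicator_vector Sp mE.
suff -> : x = 0 by rewrite rnorm0 expr0n.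
apply: total => -[i n]; rewrite /orbit_system/=; apply: model_orthogonal => q Sq.
have [qp|qp] := eqVneq q p; last first.
  apply: filterS (xE q Sq) => z /(_ I) -> _.
  by rewrite /slot_indicator (negbTE qp)/= mul0r.
subst q.
have g0 : ae_eq (mu_ p.1) E (fun z => (rnorm (U (g i) p z) ^+ 2)%:E) (cst 0%E).
  apply/(ae_eq_integral_abs _ mE).
    apply: measurable_funS (measurable_rnorm_sqr _) => //.
    exact: measurable_model.
  rewrite -[RHS](gE i) /density; apply: eq_integral => z _.
  by rewrite gee0_abs// lee_fin sqr_ge0.
apply: filterS3 (xE p Sp) (model_iter n (g i) Sp) g0.
move=> z /(_ I) -> /(_ I) -> gz _ /=.
rewrite /slot_indicator eqxx/=; case: ifPn => [/set_mem Ez|_]; last by rewrite mul0r.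
have /eqP := gz Ez; rewrite eqe sqrf_eq0 rnorm_eq0 => /eqP ->.
by rewrite mulr0 mulr0.
Qed.

(** Multiplication by [z] preserves the norm of what lives on the circle. *)
Lemma slot_indicator_isometric p x : summands p ->
  sum_ae_eq mu_ (U x) (slot_indicator p (unit_circle R)) ->
  forall n, rnorm (iter n A x) = rnorm x.
Proof.
move=> Sp xE n; apply/eqP; rewrite -(@eqrXn2 _ 2) ?rnorm_ge0//; apply/eqP/EFin_inj.
rewrite -!U_isometry; apply: eq_esum => q Sq; apply: ge0_ae_eq_integral => //.
- by apply: measurable_rnorm_sqr; exact: measurable_model.
- by apply: measurable_rnorm_sqr; exact: measurable_model.
- by move=> z _; rewrite lee_fin sqr_ge0.
- by move=> z _; rewrite lee_fin sqr_ge0.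
apply: filterS2 (model_iter n x Sq) (xE q Sq) => z /(_ I) -> /(_ I) -> _.
rewrite /slot_indicator; case: ifPn => [/andP[_ /set_mem/unit_circleE z1]|_].
  by rewrite mulr1 rnormX z1 expr1n rnorm1.
by rewrite mulr0.
Qed.

End model.

(** * The scalar spectral measure *)

Section scalar_measure_null.
Context (R : realType) (H : completeNormedModType R[i]).
Context (ip : {dot H for @conjc R}).
Hypothesis H_hilbert : forall x : H, `|x| ^+ 2 = ip x x.
Context (A : {linear H -> H}) (mu : {measure set R[i] -> \bar R}).
Hypothesis mu_spectral : scalar_spectral_measure A mu.
Context (G : countType) (g : G -> H).
Hypothesis total :
  forall x, (forall k, ip x (orbit_system A g k) = 0) -> x = 0.
Hypothesis g_bessel : forall i, bessel ip (fun n : nat => iter n A (g i)).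

(** Every measure [mu_ j] occurs with a summand of index [(j, 0)], so it is enough
    to look at that copy. *)
Lemma bessel_total_outside : mu (~` closed_disk R) = 0%E.
Proof.
have [mu_ [_ _ [U [U_L2 U_lin U_iso U_surj U_mult]] muE]] := mu_spectral.
have mE : measurable (~` closed_disk R).
  by apply: measurableC; exact: measurable_closed_disk.
rewrite muE// esum1// => j _.
have Sp : summands (j, 0%N) by case: j.
apply: (model_null_of_total H_hilbert U_L2 U_lin U_iso U_surj U_mult _ Sp mE total).
  by move=> k; rewrite -ge0_fin_numE// fin_num_measure.
move=> i; have [b b0 gb] := g_bessel i.
(* [b] may be 0, whereas [bessel_synthesis] needs a positive bound. *)
apply: (@density_outside _ _ _ (measurable_model U_L2 (g i) Sp) (b + 1)).
apply: (model_poly_bound H_hilbert U_L2 U_lin U_iso U_mult _ _ Sp).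
  by rewrite ltr_wpDl.
move=> y; apply: (le_trans (gb y)).
by rewrite lee_fin ler_wpM2r ?sqr_ge0// lerDl.
Qed.

Lemma bessel_total_circle E : measurable E -> arc_length R E = 0%E ->
  mu (E `&` unit_circle R) = 0%E.
Proof.
move=> mE E0.
have [mu_ [_ _ [U [U_L2 U_lin U_iso U_surj U_mult]] muE]] := mu_spectral.
have mEC : measurable (E `&` unit_circle R).
  by apply: measurableI => //; exact: measurable_unit_circle.
rewrite muE// esum1// => j _.
have Sp : summands (j, 0%N) by case: j.
apply: (model_null_of_total H_hilbert U_L2 U_lin U_iso U_surj U_mult _ Sp mEC total).
  by move=> k; rewrite -ge0_fin_numE// fin_num_measure.
move=> i; have [b b0 gb] := g_bessel i.
(* [b] may be 0, whereas [bessel_synthesis] needs a positive bound. *)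
have b10 : 0 < b + 1 by rewrite ltr_wpDl.
apply: (@density_circle_null _ _ _ (measurable_model U_L2 (g i) Sp) (b + 1)) => //.
  exact: ltW.
apply: (model_poly_bound H_hilbert U_L2 U_lin U_iso U_mult b10 _ Sp).
move=> y; apply: (le_trans (gb y)).
by rewrite lee_fin ler_wpM2r ?sqr_ge0// lerDl.
Qed.

End scalar_measure_null.

(** The indicator of the circle in a summand has an orbit of constant norm,
    which a frame of orbits rules out unless the circle is null. *)
Lemma frame_circle (R : realType) (H : completeNormedModType R[i])
    (ip : {dot H for @conjc R})
    (H_hilbert : forall x : H, `|x| ^+ 2 = ip x x)
    (A : {linear H -> H}) (mu : {measure set R[i] -> \bar R})
    (G : countType) (g : G -> H) :
  normal_operator ip A -> scalar_spectral_measure A mu ->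
  frame ip (orbit_system A g) -> mu (unit_circle R) = 0%E.
Proof.
move=> [B [AB ABC]] [mu_ [_ _ [U [U_L2 U_lin U_iso U_surj U_mult]] muE]] fg.
have mC := measurable_unit_circle R.
rewrite muE// esum1// => j _.
have Sp : summands (j, 0%N) by case: j.
have [|x [xE xn]] := slot_indicator_vector U_L2 U_iso U_surj _ Sp mC.
  by move=> k; rewrite -ge0_fin_numE// fin_num_measure.
have x0 : x = 0.
  apply: (frame_orbit_isometric H_hilbert AB ABC fg).
  exact: (slot_indicator_isometric U_L2 U_iso U_mult Sp xE).
by rewrite -[LHS]xn x0 rnorm0 expr0n.
Qed.

Unset Implicit Arguments.
Set Strict Implicit.
Set Printing Implicit Defensive.

Theorem theorem5p1 (R : realType) (H : completeNormedModType R[i])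
    (ip : {dot H for @conjc R})
    (H_hilbert : forall x : H, `|x| ^+ 2 = ip x x)
    (H_infinite_dimensional : infinite_dimensional H)
    (H_separable : separable H)
    (A : {linear H -> H})
    (A_bounded : bounded_operator A)
    (A_normal : normal_operator ip A)
    (mu : {measure set R[i] -> \bar R})
    (mu_spectral : scalar_spectral_measure A mu)
    (G : countType) (g : G -> H) :
  (complete_system (orbit_system A g) ->
   (forall i : G, bessel ip (fun n : nat => iter n A (g i))) ->
   mu (~` closed_disk R) = 0%E /\
   mrestr mu (measurable_unit_circle R) `<< arc_length R) /\
  (frame ip (orbit_system A g) -> mu (~` open_disk R) = 0%E).
Proof.
split=> [complete_g bessel_g|frame_g].
  have total x : (forall k, ip x (orbit_system A g k) = 0) -> x = 0.
    exact: (orthogonal_complete H_hilbert complete_g).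
  split; first exact: (bessel_total_outside H_hilbert mu_spectral total bessel_g).
  move=> E E0 B mB BE.
  exact: (bessel_total_circle H_hilbert mu_spectral total bessel_g mB (E0 B mB BE)).
have total x : (forall k, ip x (orbit_system A g k) = 0) -> x = 0.
  exact: (frame_orthogonal frame_g).
have bessel_g := frame_orbit_bessel frame_g.
have -> : ~` open_disk R = ~` closed_disk R `|` unit_circle R.
  apply/seteqP; split=> z.
    by move=> zo; have [zc|zc] := pselect (closed_disk R z); [right|left].
  by case=> [zc zo|[]//]; apply: zc; move: zo; rewrite /open_disk/= => /ltW.
apply/eqP.
rewrite measureU0 ?(frame_circle H_hilbert A_normal mu_spectral frame_g)//.
- by rewrite (bessel_total_outside H_hilbert mu_spectral total bessel_g).
- by apply: measurableC; exact: measurable_closed_disk.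
- exact: measurable_unit_circle.
Qed.
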